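(* Let $k\ge 1$ and let $G=(V,E)$ be a $k$-partite, $k$-uniform hypergraph with given vertex partition $V=V_1\cup\dots\cup V_k$. Then $G$ is representable (by a point line cover instance in $\mathbb{R}^k$) if and only if $G$ is vertex-separable.
   Context: Every hyperedge of $G$ contains exactly one vertex of each part $V_i$. $G$ is representable if there exist a finite set $P\subseteq\mathbb{R}^k$, an injective assignment of a point $p^e\in P$ to each hyperedge $e\in E$ with $P=\{p^e: e\in E\}$, and an injective assignment to each vertex $v\in V_i$ of a line $\ell^v\subseteq\mathbb{R}^k$ parallel to the $i$-th coordinate axis (i.e. all coordinates except the $i$-th are fixed), such that for all $v\in V$ and $e\in E$: $v\in e$ if and only if $p^e\in\ell^v$. (Equivalently, $G$ is isomorphic, respecting the parts, to the hypergraph $G_P$ whose vertices are the axis-parallel lines containing a point of $P$, with lines parallel to the $i$-th axis forming part $i$, and whose hyperedges are, for each $p\in P$, the set of the $k$ axis-parallel lines through $p$.) For vertices $s,t$, an $s$--$t$ path is a sequence of vertices $s=v_1,\dots,v_r=t$ such that for every $i\in[r-1]$ the vertices $v_i,v_{i+1}$ lie in a common hyperedge. Two distinct vertices $v,v'$ in the same part $V_i$ are separable if there exists $j\in[k]$, $j\neq i$, such that every $v$--$v'$ path contains a vertex of $V_j$; $G$ is vertex-separable if every two distinct vertices from the same part are separable. *)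

(* Defs.v *)
From HB Require Import structures.
From mathcomp Require Import all_boot all_order all_algebra.
From mathcomp Require Import boolp classical_sets functions cardinality reals.

Set Implicit Arguments.
Unset Strict Implicit.
Unset Printing Implicit Defensive.

(* The partition into k labelled, possibly empty, parts is the map [part].
   Hyperedges form a set of vertex sets, so there are no repeated hyperedges;
   k-uniformity follows from [edge_part]. *)
Record kpartite_hypergraph (k : nat) := KPartiteHypergraph {
  vertex : finType;
  part : vertex -> 'I_k;
  edges : {set {set vertex}};
  edge_part : forall (e : {set vertex}) (i : 'I_k),
    e \in edges -> #|[set v in e | part v == i]| = 1
}.

Definition adjacent (k : nat) (G : kpartite_hypergraph k) : rel (vertex G) :=
  fun v w => [exists e in edges G, (v \in e) && (w \in e)].

(* [s :: p] is the vertex sequence of the path, so [p = [::]] is the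
   one-vertex path. *)
Definition is_path (k : nat) (G : kpartite_hypergraph k)
    (s t : vertex G) (p : seq (vertex G)) : Prop :=
  path (@adjacent k G) s p /\ last s p = t.

Definition separable (k : nat) (G : kpartite_hypergraph k)
    (v v' : vertex G) : Prop :=
  exists j : 'I_k, j != part v /\
    forall p : seq (vertex G), is_path v v' p ->
      exists w : vertex G, w \in v :: p /\ part w = j.

Definition vertex_separable (k : nat) (G : kpartite_hypergraph k) : Prop :=
  forall v v' : vertex G, v != v' -> part v = part v' -> separable v v'.

Local Open Scope classical_set_scope.
Local Open Scope ring_scope.

Definition axis_parallel_line (R : realType) (k : nat) (i : 'I_k)
    (l : set 'rV[R]_k) : Prop :=
  exists q : 'rV[R]_k,
    l = [set x : 'rV[R]_k | forall j : 'I_k, j != i -> x 0 j = q 0 j].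

(* The values of [pt] outside [edges G] are irrelevant. *)
Definition representable (R : realType) (k : nat)
    (G : kpartite_hypergraph k) : Prop :=
  exists (P : set 'rV[R]_k) (pt : {set vertex G} -> 'rV[R]_k)
         (line : vertex G -> set 'rV[R]_k),
    [/\ finite_set P,
        {in edges G &, injective pt} /\ P = pt @` [set` edges G],
        injective line,
        (forall v : vertex G, axis_parallel_line (part v) (line v)) &
        forall (v : vertex G) (e : {set vertex G}),
          e \in edges G -> (v \in e <-> line v (pt e))].

(* Main.v *)
(* If [G] is represented, two adjacent vertices outside part [j] have lines
   meeting in a point, so these lines have the same [j]-th coordinate; hence a
   path avoiding part [j] joins lines that agree in coordinate [j], whereas two
   distinct parallel lines differ in some coordinate. Conversely, take as [j]-th
   coordinate of a vertex outside part [j] a number naming its connected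
   component in the graph with part [j] deleted. The vertices of a hyperedge
   outside part [j] are all in the same component, which defines the points, and
   separability says exactly that distinct vertices of one part get distinct
   lines. *)
Require Import Defs.
From HB Require Import structures.
From mathcomp Require Import all_boot all_order all_algebra.
From mathcomp Require Import boolp classical_sets functions cardinality reals.

Set Implicit Arguments.
Unset Strict Implicit.
Unset Printing Implicit Defensive.

Import GRing.Theory Num.Theory.

Local Open Scope ring_scope.

Definition axis_line (R : realType) (k : nat) (i : 'I_k) (q : 'rV[R]_k) :
    set 'rV[R]_k :=
  [set x : 'rV[R]_k | forall j, j != i -> x 0 j = q 0 j]%classic.

Lemma axis_line_eq (R : realType) (k : nat) (i : 'I_k) (q q' : 'rV[R]_k) :
  (forall j, j != i -> q 0 j = q' 0 j) -> axis_line i q = axis_line i q'.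
Proof. by move=> eqq; apply/seteqP; split=> x xq j ji; rewrite xq ?eqq. Qed.

(** Coordinate [i] is free on the first line but would be fixed on the second if [i != i']; this
    lets [line] be injective across parts. *)
Lemma axis_line_dir (R : realType) (k : nat) (i i' : 'I_k) (q q' : 'rV[R]_k) :
  axis_line i q = axis_line i' q' -> i = i'.
Proof.
move=> eql; apply/eqP/negPn/negP => ii'.
pose x : 'rV[R]_k := \row_j (if j == i then q' 0 i + 1 else q 0 j).
have : axis_line i q x by move=> j /negPf ji; rewrite mxE ji.
rewrite eql => /(_ _ ii'); rewrite mxE eqxx => /eqP.
by rewrite -subr_eq0 addrC addKr oner_eq0.
Qed.

Lemma representable_vertex_separable (R : realType) (k : nat)
    (G : kpartite_hypergraph k) :
  representable R G -> vertex_separable G.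
Proof.
move=> [P [pt [line [_ _ line_inj line_axis incid]]]] v v' vv' pvv'.
have [q qE] := choice line_axis.
apply: contrapT => Nsep; move/negP: vv'; apply; apply/eqP; apply: line_inj.
rewrite qE (qE v') -pvv'; apply: axis_line_eq => j jv.
apply: contrapT => Nq; apply: Nsep; exists j; split=> // p [].
(* The start moves along the path, so [pvv'] is dropped; the invariant is that the start lies
   outside part [j] and differs from [v'] in coordinate [j]. *)
elim: p v jv {pvv'} Nq => [|w p IHp] v jv Nq /=; first by move=> _ vE; subst.
move=> /andP[/existsP[e /and3P[eG ve we]] pathp] lastp.
have [wj|wj] := eqVneq j (part w).
  by exists w; rewrite !inE eqxx orbT.
have qvw : q v 0 j = q w 0 j.
  have := (incid v e eG).1 ve; rewrite qE => /(_ _ jv) <-.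
  by have := (incid w e eG).1 we; rewrite qE => /(_ _ wj) ->.
rewrite qvw in Nq; have [u [up uj]] := IHp w wj Nq pathp lastp.
by exists u; rewrite inE up orbT.
Qed.

(** Deletion of part [j] keeps the vertex type: the vertices of part [j] become isolated. *)
Definition adjacent_avoiding (k : nat) (G : kpartite_hypergraph k) (j : 'I_k) :
    rel (vertex G) :=
  [rel v w | [&& adjacent v w, part v != j & part w != j]].

Lemma connect_adjacent_avoiding_sym (k : nat) (G : kpartite_hypergraph k)
    (j : 'I_k) : connect_sym (@adjacent_avoiding k G j).
Proof.
apply: sym_connect_sym => v w; rewrite /adjacent_avoiding /=.
rewrite [(part v != j) && _]andbC; congr (_ && _).
by apply: eq_existsb => e; rewrite [(v \in e) && _]andbC.
Qed.

Lemma edge_vertex (k : nat) (G : kpartite_hypergraph k) (e : {set vertex G})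
    (i : 'I_k) : e \in edges G -> exists2 w, w \in e & part w = i.
Proof.
move=> eG; have /eqP/cards1P[w wE] := edge_part i eG.
have : w \in [set v in e | part v == i] by rewrite wE set11.
by rewrite inE => /andP[we /eqP wi]; exists w.
Qed.

Definition component_code (R : realType) (k : nat) (G : kpartite_hypergraph k)
    (j : 'I_k) (v : vertex G) : R :=
  (enum_rank (fingraph.root (@adjacent_avoiding k G j) v))%:R.

Lemma component_code_edge (R : realType) (k : nat) (G : kpartite_hypergraph k)
    (j : 'I_k) (e : {set vertex G}) (v w : vertex G) :
    e \in edges G -> v \in e -> w \in e -> part v != j -> part w != j ->
  component_code R j v = component_code R j w.
Proof.
move=> eG ve we vj wj; congr (nat_of_ord (enum_rank _))%:R.
apply/eqP; rewrite (root_connect (@connect_adjacent_avoiding_sym k G j)).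
apply: connect1; apply/and3P; split=> //.
by apply/existsP; exists e; apply/and3P.
Qed.

(** Equal codes at the separating index [j] give a path from [v] to [v'] that avoids part [j]. *)
Lemma component_code_inj (R : realType) (k : nat) (G : kpartite_hypergraph k)
    (v v' : vertex G) :
    vertex_separable G -> part v = part v' ->
    (forall j, j != part v -> component_code R j v = component_code R j v') ->
  v = v'.
Proof.
move=> sepG pvv' codevv'; apply/eqP/negPn/negP => vv'.
have [j [jv pathj]] := sepG v v' vv' pvv'.
have /eqP := codevv' j jv; rewrite eqr_nat => /eqP/val_inj/enum_rank_inj/eqP.
rewrite (root_connect (@connect_adjacent_avoiding_sym k G j)).
case/connectP=> p pathp lastp; have [|w [wp wj]] := pathj p.
  by split=> //; apply: sub_path pathp => x y /and3P[].
suff : part w != j by rewrite wj eqxx.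
move: wp; rewrite inE => /predU1P[->|]; first by rewrite eq_sym.
elim: p v pathp {jv pvv' codevv' vv' pathj lastp} => //= x p IHp v.
by case/andP=> /and3P[_ _ xj] pathp; rewrite inE => /predU1P[->//|wp];
  apply: IHp pathp wp.
Qed.

Lemma vertex_separable_representable (R : realType) (k : nat)
    (G : kpartite_hypergraph k) :
  vertex_separable G -> representable R G.
Proof.
move=> sepG.
pose q (v : vertex G) : 'rV[R]_k := \row_j component_code R j v.
(* On hyperedges the default [0] is reached for [k = 1] only. *)
pose pt (e : {set vertex G}) : 'rV[R]_k :=
  \row_j oapp (@component_code R k G j) 0 [pick w in e | part w != j].
pose line v := axis_line (part v) (q v).
have ptE e v j : e \in edges G -> v \in e -> j != part v ->
    pt e 0 j = component_code R j v.
  move=> eG ve jv; rewrite mxE; case: pickP => [w /andP[we wj]|/(_ v)] /=.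
    by apply: (component_code_edge R eG) => //; rewrite eq_sym.
  by rewrite ve eq_sym jv.
have incid v e : e \in edges G -> (v \in e <-> line v (pt e)).
  move=> eG; split=> [ve j jv|vpt]; first by rewrite (ptE e v) // mxE.
  (* The lines of [v] and of the vertex [w] of [e] in the same part are parallel and share [pt e],
     so all relevant codes agree. *)
  have [w we wv] := edge_vertex (part v) eG.
  suff -> : v = w by [].
  apply: (component_code_inj (R := R) sepG) => // j jv.
  by rewrite -(ptE e w) ?wv // vpt // mxE.
exists (pt @` [set` edges G])%classic, pt, line; split=> //.
- exact/finite_image/finite_finset.
(* By [incid], a hyperedge is recovered from its point as the set of vertices whose lines contain
   that point. *)
- split=> // e e' eG e'G ptee'; apply/setP => v; apply/idP/idP => ve.
    by apply/(incid v e' e'G); rewrite -ptee'; apply/incid.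
  by apply/(incid v e eG); rewrite ptee'; apply/incid.
- move=> v v' eql; have pvv' := axis_line_dir eql.
  apply: (component_code_inj (R := R) sepG pvv') => j jv.
  have : line v (q v) by [].
  by rewrite eql => /(_ j); rewrite -pvv' !mxE; apply.
- by move=> v; exists (q v).
Qed.

Local Close Scope ring_scope.

Theorem theorem6 (R : realType) (k : nat) (k_ge1 : 1 <= k)
    (G : kpartite_hypergraph k) :
  representable R G <-> vertex_separable G.
Proof.
split; first exact: representable_vertex_separable.
exact: vertex_separable_representable.
Qed.
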